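(* Let $n\geq 1$ and $p\ge2$ be integers. The relation $\sim$ (''having the same dynamics'') on the principal 3D slices $\mathcal{T}^p(\mathbf{i}_{\mathbf{m}},\mathbf{i}_{\mathbf{k}},\mathbf{i}_{\mathbf{l}})$ of the Multibrot set $\mathcal{M}_n^p$ is an equivalence relation.
   Context: Multicomplex numbers: $\mathbb{M}(0)=\mathbb{R}$ and, for $n\geq1$, $\mathbb{M}(n)=\{\eta_1+\eta_2 i_n:\eta_1,\eta_2\in\mathbb{M}(n-1)\}$ with $i_n^2=-1$, with operations $(\eta_1+\eta_2 i_n)+(\zeta_1+\zeta_2 i_n)=(\eta_1+\zeta_1)+(\eta_2+\zeta_2)i_n$ and $(\eta_1+\eta_2 i_n)(\zeta_1+\zeta_2 i_n)=(\eta_1\zeta_1-\eta_2\zeta_2)+(\eta_1\zeta_2+\eta_2\zeta_1)i_n$. This is a commutative unital ring and a real vector space. $\mathbb{I}(n)$ is the set of the $2^n$ products of distinct elements of $\{i_1,\dots,i_n\}$, including the empty product $1$; it is an $\mathbb{R}$-basis of $\mathbb{M}(n)$. The norm on $\mathbb{M}(n)$ is the Euclidean norm of the coordinates in this basis. For $p\ge2$ and $c\in\mathbb{M}(n)$, $Q_{p,c}(\eta)=\eta^p+c$, and $Q_{p,c}^t$ is its $t$-th iterate. $\mathcal{M}_n^p=\{c\in\mathbb{M}(n):\{Q_{p,c}^t(0)\}_{t=1}^\infty\text{ is bounded}\}$. For pairwise distinct $\mathbf{i}_{\mathbf{m}},\mathbf{i}_{\mathbf{k}},\mathbf{i}_{\mathbf{l}}\in\mathbb{I}(n)$: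 $\mathbb{T}(\mathbf{i}_{\mathbf{m}},\mathbf{i}_{\mathbf{k}},\mathbf{i}_{\mathbf{l}})=\mathrm{span}_{\mathbb{R}}\{\mathbf{i}_{\mathbf{m}},\mathbf{i}_{\mathbf{k}},\mathbf{i}_{\mathbf{l}}\}$; the principal 3D slice is $\mathcal{T}^p(\mathbf{i}_{\mathbf{m}},\mathbf{i}_{\mathbf{k}},\mathbf{i}_{\mathbf{l}})=\{c\in\mathbb{T}(\mathbf{i}_{\mathbf{m}},\mathbf{i}_{\mathbf{k}},\mathbf{i}_{\mathbf{l}}):\{Q_{p,c}^t(0)\}_{t=1}^\infty\text{ is bounded}\}$ (always considered together with its triple of units); $\mathrm{It}^p(\mathbf{i}_{\mathbf{m}},\mathbf{i}_{\mathbf{k}},\mathbf{i}_{\mathbf{l}})=\mathrm{span}_{\mathbb{R}}\{Q_{p,c}^t(0):c\in\mathbb{T}(\mathbf{i}_{\mathbf{m}},\mathbf{i}_{\mathbf{k}},\mathbf{i}_{\mathbf{l}}),\ t\in\{1,2,3,\dots\}\}$. Relation $\sim$: for slices $\mathcal{T}_1^p(\mathbf{i}_{\mathbf{m}},\mathbf{i}_{\mathbf{k}},\mathbf{i}_{\mathbf{l}})$ and $\mathcal{T}_2^p(\mathbf{i}_{\mathbf{r}},\mathbf{i}_{\mathbf{q}},\mathbf{i}_{\mathbf{s}})$ of $\mathcal{M}_n^p$, put $M_1=\mathrm{It}^p(\mathbf{i}_{\mathbf{m}},\mathbf{i}_{\mathbf{k}},\mathbf{i}_{\mathbf{l}})$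 and $M_2=\mathrm{It}^p(\mathbf{i}_{\mathbf{r}},\mathbf{i}_{\mathbf{q}},\mathbf{i}_{\mathbf{s}})$. Then $\mathcal{T}_1^p\sim\mathcal{T}_2^p$ if there is an $\mathbb{R}$-linear bijection $\varphi:M_1\to M_2$ such that $\varphi(\mathbb{T}(\mathbf{i}_{\mathbf{m}},\mathbf{i}_{\mathbf{k}},\mathbf{i}_{\mathbf{l}}))=\mathbb{T}(\mathbf{i}_{\mathbf{r}},\mathbf{i}_{\mathbf{q}},\mathbf{i}_{\mathbf{s}})$ and, for all $c\in\mathbb{T}(\mathbf{i}_{\mathbf{m}},\mathbf{i}_{\mathbf{k}},\mathbf{i}_{\mathbf{l}})$ and all $\eta\in M_2$, $(\varphi\circ Q_{p,c}\circ\varphi^{-1})(\eta)=Q_{p,\varphi(c)}(\eta)$. *)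

(* Defs.v *)
From HB Require Import structures.
From mathcomp Require Import all_boot all_order all_algebra.
From mathcomp Require Import ring.
From mathcomp Require Import boolp classical_sets reals.

Set Implicit Arguments.
Unset Strict Implicit.
Unset Printing Implicit Defensive.

Import Order.TTheory GRing.Theory Num.Theory.

Local Open Scope classical_set_scope.
Local Open Scope ring_scope.

(* One doubling step: [Dbl x y] is x + y i with i ^+ 2 = -1, over an arbitrary
   commutative R-algebra A.  (The library's pairs carry the componentwise
   product and [complex] needs a real field, so neither can be iterated.) *)
Record dbl (A : Type) : Type := Dbl { dfst : A; dsnd : A }.

Section DblAlgebra.

Definition dbl_pair (A : Type) (x : dbl A) : A * A := (dfst x, dsnd x).
Definition pair_dbl (A : Type) (x : A * A) : dbl A := Dbl x.1 x.2.

Lemma dbl_pairK (A : Type) : cancel (@dbl_pair A) (@pair_dbl A).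
Proof. by case. Qed.

HB.instance Definition _ (A : choiceType) :=
  Choice.copy (dbl A) (can_type (@dbl_pairK A)).

Variables (R : comNzRingType) (A : comAlgType R).
Implicit Types x y z : dbl A.

Definition dbl_zero : dbl A := Dbl 0 0.
Definition dbl_one : dbl A := Dbl 1 0.
Definition dbl_opp x : dbl A := Dbl (- dfst x) (- dsnd x).
Definition dbl_add x y : dbl A := Dbl (dfst x + dfst y) (dsnd x + dsnd y).
Definition dbl_mul x y : dbl A :=
  Dbl (dfst x * dfst y - dsnd x * dsnd y) (dfst x * dsnd y + dsnd x * dfst y).
Definition dbl_scale (a : R) x : dbl A := Dbl (a *: dfst x) (a *: dsnd x).

Fact dbl_addA : associative dbl_add.
Proof. by move=> [a b] [c d] [e f]; rewrite /dbl_add /= !addrA. Qed.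
Fact dbl_addC : commutative dbl_add.
Proof. by move=> [a b] [c d]; rewrite /dbl_add /= addrC (addrC b). Qed.
Fact dbl_add0 : left_id dbl_zero dbl_add.
Proof. by move=> [a b]; rewrite /dbl_add /= !add0r. Qed.
Fact dbl_addN : left_inverse dbl_zero dbl_opp dbl_add.
Proof. by move=> [a b]; rewrite /dbl_add /= !addNr. Qed.

HB.instance Definition _ := GRing.isZmodule.Build (dbl A)
  dbl_addA dbl_addC dbl_add0 dbl_addN.

Fact dbl_mulA : associative dbl_mul.
Proof. by move=> [a b] [c d] [e f]; congr Dbl => /=; ring. Qed.
Fact dbl_mulC : commutative dbl_mul.
Proof. by move=> [a b] [c d]; congr Dbl => /=; ring. Qed.
Fact dbl_mul1 : left_id dbl_one dbl_mul.
Proof. by move=> [a b]; congr Dbl => /=; ring. Qed.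
Fact dbl_mulD : left_distributive dbl_mul dbl_add.
Proof. by move=> [a b] [c d] [e f]; congr Dbl => /=; ring. Qed.
Fact dbl_one_neq0 : dbl_one != dbl_zero.
Proof. by apply/eqP => -[/eqP]; rewrite oner_eq0. Qed.

HB.instance Definition _ := GRing.Zmodule_isComNzRing.Build (dbl A)
  dbl_mulA dbl_mulC dbl_mul1 dbl_mulD dbl_one_neq0.

Fact dbl_scaleA a b x : dbl_scale a (dbl_scale b x) = dbl_scale (a * b) x.
Proof. by rewrite /dbl_scale /= !scalerA. Qed.
Fact dbl_scale1 : left_id 1 dbl_scale.
Proof. by move=> [a b]; rewrite /dbl_scale /= !scale1r. Qed.
Fact dbl_scaleDr : right_distributive dbl_scale +%R.
Proof. by move=> a [b c] [d e]; congr Dbl; rewrite /= scalerDr. Qed.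
Fact dbl_scaleDl x : {morph dbl_scale^~ x : a b / a + b}.
Proof. by move=> a b; congr Dbl; rewrite /= scalerDl. Qed.

HB.instance Definition _ := GRing.Zmodule_isLmodule.Build R (dbl A)
  dbl_scaleA dbl_scale1 dbl_scaleDr dbl_scaleDl.

Fact dbl_scaleAl (a : R) x y : a *: (x * y) = (a *: x) * y.
Proof.
by case: x y => [b c] [d e]; congr Dbl;
   rewrite /= -!scalerAl ?scalerBr ?scalerDr.
Qed.

HB.instance Definition _ := GRing.Lmodule_isLalgebra.Build R (dbl A) dbl_scaleAl.
HB.instance Definition _ := GRing.Lalgebra_isComAlgebra.Build R (dbl A).

End DblAlgebra.

Section Span.
Variables (R : nzRingType) (V : lmodType R).

Definition lspan (S : set V) : {pred V} := mem [set x : V |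
  exists (k : nat) (a : 'I_k -> R) (v : 'I_k -> V),
    (forall i, S (v i)) /\ x = \sum_(i < k) a i *: v i].

Variable S : set V.

Fact lspan_submod_closed : submod_closed (lspan S).
Proof.
split.
  by apply/mem_set; exists 0, (fun=> 0), (fun=> 0); split=> [[]//|]; rewrite big_ord0.
move=> a x y /set_mem[k [b [v [Sv ->]]]] /set_mem[l [c [w [Sw ->]]]].
apply/mem_set; exists (k + l)%N.
exists (fun i => match split i with inl i => a * b i | inr j => c j end).
exists (fun i => match split i with inl i => v i | inr j => w j end).
split=> [i|]; first by case: (split i).
rewrite big_split_ord scaler_sumr; congr (_ + _); apply: eq_bigr => i _.
  by rewrite (unsplitK (inl i)) scalerA.
by rewrite (unsplitK (inr i)).
Qed.

HB.instance Definition _ :=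
  GRing.isSubmodClosed.Build R V (lspan S) lspan_submod_closed.

Record lspan_type : Type :=
  LSpan { lspan_val :> V; _ : lspan_val \in lspan S }.

HB.instance Definition _ := [isSub for lspan_val].
HB.instance Definition _ := [Choice of lspan_type by <:].
HB.instance Definition _ := [SubChoice_isSubLmodule of lspan_type by <:].

End Span.

Section Multicomplex.
Variable R : realType.

Fixpoint multicomplex (n : nat) : comAlgType R :=
  if n is n'.+1 then dbl (multicomplex n') else R^o.

(* [im_unit j] is i_(j+1); the outermost unit i_(n+1) of M(n+1) is
   [im_unit ord_max]. *)
Fixpoint im_unit (n : nat) : 'I_n -> multicomplex n :=
  match n with
  | 0 => fun=> 0
  | n'.+1 => fun j =>
      if unlift ord_max j is Some j' then Dbl (im_unit j') 0 else Dbl 0 1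
  end.

Definition prod_unit (n : nat) (A : {set 'I_n}) : multicomplex n :=
  \prod_(j in A) im_unit j.

Definition units (n : nat) : set (multicomplex n) := range (@prod_unit n).

(* Coordinate along [prod_unit A]; [coord_sum] and [coord_unit] show that these
   are the coordinates in the basis [units n]. *)
Fixpoint coord (n : nat) : {set 'I_n} -> multicomplex n -> R :=
  match n with
  | 0 => fun _ x => x
  | n'.+1 => fun A x =>
      coord ([set j | lift ord_max j \in A]%SET)
            (if ord_max \in A then dsnd x else dfst x)
  end.

Fact coord_is_linear (n : nat) (A : {set 'I_n}) (a : R) (x y : multicomplex n) :
  coord A (a *: x + y) = a * coord A x + coord A y.
Proof. by elim: n A x y => [//|n IHn] A x y /=; case: ifP => _; apply: IHn. Qed.

HB.instance Definition _ (n : nat) (A : {set 'I_n}) :=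
  GRing.isLinear.Build R (multicomplex n) R *%R (coord A) (coord_is_linear A).

Lemma prod_unitS (n : nat) (A : {set 'I_n.+1}) :
  prod_unit A =
  let u := prod_unit ([set j | lift ord_max j \in A]%SET) in
  if ord_max \in A then Dbl 0 u else Dbl u 0.
Proof.
set B := [set j | _]%SET => /=.
pose f (x : multicomplex n) : multicomplex n.+1 := Dbl x 0.
have fM : {morph f : x y / x * y} by move=> x y; congr Dbl => /=; ring.
have -> : prod_unit A = f (prod_unit B) * (if ord_max \in A then Dbl 0 1 else 1).
  rewrite /prod_unit [LHS]big_mkcond big_ord_recr /= unlift_none; congr (_ * _).
  rewrite (big_morph f fM (erefl _)) [RHS]big_mkcond; apply: eq_bigr => j _.
  have -> : widen_ord (leqnSn n) j = lift ord_max j.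
    by apply: val_inj; rewrite /= /bump leqNgt ltn_ord.
  by rewrite liftK inE.
case: ifP => _; last by rewrite mulr1.
by congr Dbl => /=; ring.
Qed.

Lemma coord_unit (n : nat) (A B : {set 'I_n}) :
  coord A (prod_unit B) = (A == B)%:R.
Proof.
elim: n => [|n IHn] in A B *.
  have e (C : {set 'I_0}) : C = finset.set0 by apply/setP => -[].
  by rewrite (e A) (e B) eqxx /prod_unit big_set0.
rewrite prod_unitS /=.
have eqAB : (A == B) = ((ord_max \in A) == (ord_max \in B)) &&
    ([set j | lift ord_max j \in A]%SET == [set j | lift ord_max j \in B]%SET).
  apply/eqP/andP => [-> //|[/eqP eM /eqP/setP eL]].
  apply/setP => j; case: (unliftP ord_max j) => [k ->|-> //].
  by have := eL k; rewrite !inE.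
rewrite eqAB.
by case: (ord_max \in A); case: (ord_max \in B) => /=;
   rewrite ?IHn ?linear0.
Qed.

Lemma coord_inj (n : nat) (x y : multicomplex n) :
  (forall A, coord A x = coord A y) -> x = y.
Proof.
elim: n => [|n IHn] in x y * => exy; first exact: (exy finset.set0).
have mem_im (B : {set 'I_n}) : [set j | lift ord_max j \in lift ord_max @: B]%SET = B.
  by apply/setP => j; rewrite inE mem_imset //; apply: lift_inj.
have notin (B : {set 'I_n}) : (ord_max \in lift ord_max @: B) = false.
  by apply/imsetP => -[j _ /eqP]; rewrite (negPf (neq_lift _ _)).
case: x y exy => [x1 x2] [y1 y2] exy; congr Dbl; apply: IHn => B.
  by have := exy (lift ord_max @: B); rewrite /= notin mem_im.
have := exy (ord_max |: lift ord_max @: B); rewrite /= finset.setU11.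
suff -> : [set j | lift ord_max j \in ord_max |: lift ord_max @: B]%SET = B by [].
apply/setP => j; rewrite -[in RHS](mem_im B) !inE.
by rewrite eq_sym (negPf (neq_lift _ _)).
Qed.

Lemma coord_sum (n : nat) (x : multicomplex n) :
  x = \sum_(A : {set 'I_n}) coord A x *: prod_unit A.
Proof.
apply: coord_inj => A; rewrite linear_sum (bigD1 A) //= big1 => [|B neBA].
  by rewrite addr0 linearZ /= coord_unit eqxx mulr1.
by rewrite linearZ /= coord_unit eq_sym (negPf neBA) mulr0.
Qed.

Definition mnorm (n : nat) (x : multicomplex n) : R :=
  Num.sqrt (\sum_(A : {set 'I_n}) coord A x ^+ 2).

Definition Q (n p : nat) (c eta : multicomplex n) : multicomplex n :=
  eta ^+ p + c.

Definition bounded_orbit (n p : nat) (c : multicomplex n) : Prop :=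
  exists B : R, forall t : nat, (0 < t)%N -> mnorm (iter t (Q p c) 0) <= B.

Definition multibrot (n p : nat) : set (multicomplex n) :=
  [set c | bounded_orbit p c].

(* A principal 3D slice together with its triple of units; the underlying
   subset of M(n) is given by the coercion [slice_set] below.  The exponent p is
   a phantom parameter of the record, read by [slice_set] and [It]. *)
Record principal_slice (n p : nat) : Type := PrincipalSlice {
  unit_m : multicomplex n;
  unit_k : multicomplex n;
  unit_l : multicomplex n;
  _ : units unit_m;
  _ : units unit_k;
  _ : units unit_l;
  _ : uniq [:: unit_m; unit_k; unit_l]
}.

Section Slice.
Variables (n p : nat) (s : principal_slice n p).

Definition slice_space : {pred multicomplex n} :=
  lspan [set unit_m s; unit_k s; unit_l s].

Definition slice_set : set (multicomplex n) :=
  [set` slice_space] `&` multibrot p.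

Definition iterates : set (multicomplex n) :=
  [set x | exists (c : multicomplex n) (t : nat),
     [/\ c \in slice_space, (0 < t)%N & x = iter t (Q p c) 0]].

Definition It : lmodType R := lspan_type iterates.

End Slice.

Coercion slice_set : principal_slice >-> set.

(* It^p(s) contains the 3D space of s (take t = 1), so an element c of that
   space is quantified as c : It s with \val c \in slice_space s.  As the domain
   of phi is It s1, that Q_{p,c}(phi^-1(eta)) lies in It s1 is part of the
   conjugacy condition: zeta below is that point. *)
Definition same_dynamics (n p : nat) (s1 s2 : principal_slice n p) : Prop :=
  exists (phi : {linear It s1 -> It s2}) (phi_inv : It s2 -> It s1),
    [/\ cancel phi phi_inv, cancel phi_inv phi,
        [set \val (phi c) | c in [set c : It s1 | \val c \in slice_space s1]]
          = [set` slice_space s2] &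
        forall (c : It s1) (eta : It s2), \val c \in slice_space s1 ->
          exists2 zeta : It s1, \val zeta = Q p (\val c) (\val (phi_inv eta)) &
            \val (phi zeta) = Q p (\val (phi c)) (\val eta)].

End Multicomplex.

(* Main.v *)
(** The point is reflexivity, i.e. that [It] is stable under [eta ^+ p + c].
    The [t]-th iterate of 0 is a polynomial in [c] with nonnegative coefficients,
    whose exponents are the numbers 1 + k (p - 1); every such exponent occurs
    with positive coefficient once [t] is large.  Rescaling [c] by reals isolates
    the monomials, so [It] is the span of the powers c ^ (1 + k (p - 1)) with [c]
    in the slice space T.  By the same device applied to (c + a d) ^ (i + j), a
    product c ^ i d ^ j lies in the span of the (i + j)-th powers of elements
    of T; hence a product of [p] elements of [It] lies in the span of the powers
    with exponent p + k (p - 1), which is contained in [It]. *)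
Require Import Defs.
From HB Require Import structures.
From Corelib Require Import RelationClasses.
From mathcomp Require Import all_boot all_order all_algebra.
From mathcomp Require Import reals.
From mathcomp Require Import boolp classical_sets.

Set Implicit Arguments.
Unset Strict Implicit.
Unset Printing Implicit Defensive.

Import Order.TTheory GRing.Theory Num.Theory.

Local Open Scope classical_set_scope.
Local Open Scope ring_scope.

Section LinearSpan.
Variables (R : nzRingType) (V : lmodType R).
Implicit Types (S : set V) (W : submodClosed V).

Lemma mem_lspan S (x : V) : S x -> x \in lspan S.
Proof.
move=> Sx; apply/mem_set; exists 1, (fun=> 1), (fun=> x); split=> //.
by rewrite big_ord1 scale1r.
Qed.

Lemma lspan_min S W :
  (forall x, S x -> x \in W) -> {subset lspan S <= W}.
Proof.
move=> SW x /set_mem[k [a [v [Sv ->]]]].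
by apply: rpred_sum => i _; apply: rpredZ; apply: SW.
Qed.

End LinearSpan.

Lemma lspan_mul (R : nzRingType) (A : algType R) (S S' : set A)
    (W : submodClosed A) :
  (forall x y, S x -> S' y -> x * y \in W) ->
  forall x y, x \in lspan S -> y \in lspan S' -> x * y \in W.
Proof.
move=> SW x y /set_mem[k [a [v [Sv ->]]]] /set_mem[l [b [w [Sw ->]]]].
rewrite mulr_suml; apply: rpred_sum => i _.
rewrite mulr_sumr; apply: rpred_sum => j _.
by rewrite -scalerAl -scalerAr; do 2![apply: rpredZ]; apply: SW.
Qed.

(** * Spans of powers, and products inside them *)

Section PowerSpan.
Variables (R : numFieldType).

(* Induction on the degree: for [f a] a curve of degree [n],
   [f (2 a) - 2 ^ n f a] has no term of degree [n]. *)
Lemma mem_coef_curve (V : lmodType R) (W : submodClosed V) n (v : nat -> V) :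
  (forall a : R, \sum_(i < n) a ^+ i *: v i \in W) ->
  forall i, (i < n)%N -> v i \in W.
Proof.
elim: n v => [//|n IHn] v Wv.
have Wlt i : (i < n)%N -> v i \in W.
  move=> ltin; have d0 : (2%:R : R) ^+ i - 2%:R ^+ n != 0.
    rewrite subr_eq0 -!natrX eqr_nat eqn_exp2l //.
    by rewrite neq_ltn ltin.
  rewrite -[v i]scale1r -(mulVf d0) -scalerA; apply: rpredZ.
  apply: (IHn (fun i => (2%:R ^+ i - 2%:R ^+ n) *: v i)) ltin => a.
  have := rpredD (Wv (2%:R * a)) (rpredZ (- 2%:R ^+ n) (Wv a)).
  rewrite !big_ord_recr /= scaleNr scalerDr scalerA exprMn opprD addrACA subrr.
  rewrite addr0 scaler_sumr -sumrB.
  rewrite (eq_bigr (fun j : 'I_n => a ^+ j *: ((2%:R ^+ j - 2%:R ^+ n) *: v j))) //.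
  by move=> j _; rewrite exprMn !scalerA -scalerBl [a ^+ j * _]mulrC mulrBl.
move=> i; rewrite ltnS leq_eqVlt => /predU1P[->|]; last exact: Wlt.
(* At [a = 1] the curve is the plain sum, so subtracting the lower terms leaves [v n]. *)
have := Wv 1; rewrite big_ord_recr /= expr1n scale1r => Ws.
rewrite -(addKr (\sum_(i < n) 1 ^+ i *: v i) (v n)) addrC.
rewrite rpredD // -scaleN1r; apply: rpredZ.
by apply: rpred_sum => j _; apply: rpredZ; apply: Wlt.
Qed.

Variables (A : comAlgType R) (T : submodClosed A).

(** The offset [r] counts factors, so that offsets add under products. For [q = p - 1] and [r = 1]
    the exponents are those occurring in the orbits of 0. *)
Definition powers (q r : nat) : set A :=
  [set x | exists c k, c \in T /\ x = c ^+ (r + k * q)].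

Lemma mul_powers q r s x y :
  x \in lspan (powers q r) -> y \in lspan (powers q s) ->
  x * y \in lspan (powers q (r + s)).
Proof.
apply: lspan_mul => {}x {}y [c [k [Tc ->]]] [d [l [Td ->]]].
set i := (r + k * q)%N; set j := (s + l * q)%N.
have eij : (i + j = r + s + (k + l) * q)%N by rewrite mulnDl addnACA.
have bin0 : ('C(i + j, j)%:R : R) != 0 by rewrite pnatr_eq0 -lt0n bin_gt0 leq_addl.
rewrite -[_ * _]scale1r -(mulVf bin0) -scalerA; apply: rpredZ.
(* [v m] is the coefficient of [a ^+ m] in [(c + a *: d) ^+ (i + j)]. *)
pose v m := 'C(i + j, m)%:R *: (c ^+ (i + j - m) * d ^+ m) : A.
have -> : 'C(i + j, j)%:R *: (c ^+ i * d ^+ j) = v j by rewrite /v addnK.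
apply: (@mem_coef_curve _ _ (i + j).+1) => [a|]; last by rewrite ltnS leq_addl.
apply: mem_lspan; exists (c + a *: d), (k + l)%N; split.
  by rewrite rpredD ?rpredZ.
rewrite -eij exprDn; apply: eq_bigr => m _.
by rewrite /v exprZn -scalerAr scaler_nat scalerMnr.
Qed.

Lemma exp_powers q x j :
  x \in lspan (powers q 1) -> x ^+ j \in lspan (powers q j).
Proof.
move=> Wx; elim: j => [|j IHj].
  (* The zeroth power 1 is [0 ^+ 0], with exponent [0 + 0 * q]. *)
  by apply: mem_lspan; exists 0, 0%N; rewrite rpred0.
by rewrite exprS -add1n; apply: mul_powers.
Qed.

Lemma powers_step q r : powers q (r + q) `<=` powers q r.
Proof.
by move=> x [c [k [Tc ->]]]; exists c, k.+1; rewrite mulSn addnA.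
Qed.

(** The [p]-th power has offset [p = 1 + (p - 1)], one step further along the progression of step
    [p - 1] that starts at 1. *)
Lemma exp_powers1 p x : (0 < p)%N ->
  x \in lspan (powers p.-1 1) -> x ^+ p \in lspan (powers p.-1 1).
Proof.
move=> p_gt0 /(exp_powers p).
have {3}-> : p = (1 + p.-1)%N by rewrite add1n prednK.
by apply: lspan_min => y ys; apply: mem_lspan; apply: powers_step.
Qed.

(** * The iterates of 0 as polynomials in the parameter *)

Fixpoint orbit_poly (p t : nat) : {poly R} :=
  if t is t'.+1 then orbit_poly p t' ^+ p + 'X else 0.

Lemma horner_orbit_poly p t (c : A) :
  iter t (fun x => x ^+ p + c) 0 = horner_alg c (orbit_poly p t).
Proof.
by elim: t => [|t IHt] /=; rewrite ?rmorph0 // IHt rmorphD rmorphXn /= horner_algX.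
Qed.

Definition coef_nonneg (f : {poly R}) := forall i, 0 <= f`_i.

Lemma coef_nonneg_exp f j : coef_nonneg f -> coef_nonneg (f ^+ j).
Proof.
move=> f0; elim: j => [|j IHj] i; first by rewrite expr0 coef1 ler0n.
by rewrite exprS coefM; apply: sumr_ge0 => k _; apply: mulr_ge0.
Qed.

(** Nonnegativity rules out cancellation, so one positive term of the convolution suffices. *)
Lemma coef_mul_gt0 f g i j : coef_nonneg f -> coef_nonneg g ->
  0 < f`_i -> 0 < g`_j -> 0 < (f * g)`_(i + j).
Proof.
move=> f0 g0 fi gj.
have lti : (i < (i + j).+1)%N by rewrite ltnS leq_addr.
rewrite coefM (bigD1 (Ordinal lti)) //= addKn.
apply: ltr_wpDr; last by rewrite mulr_gt0.
by apply: sumr_ge0 => k _; apply: mulr_ge0.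
Qed.

Lemma coef_exp_gt0 f j : coef_nonneg f -> 0 < f`_1 -> 0 < (f ^+ j)`_j.
Proof.
move=> f0 f1; elim: j => [|j IHj]; first by rewrite expr0 coef1.
by rewrite exprS -add1n; apply: coef_mul_gt0 => //; apply: coef_nonneg_exp.
Qed.

Lemma orbit_poly_ge0 p t : coef_nonneg (orbit_poly p t).
Proof.
elim: t => [|t IHt] i /=; first by rewrite coef0.
by rewrite coefD coefX addr_ge0 ?ler0n //; apply: coef_nonneg_exp.
Qed.

(** Induction on [t]: ['X] settles [k = 0]. For [k + 1], write [f ^+ p = f * f ^+ (p - 1)] and
    combine degree [1 + k (p - 1)] of [f] with degree [p - 1] of the second factor, positive because
    [f] has a positive linear coefficient. *)
Lemma orbit_poly_gt0 p t k : (0 < p)%N -> (k < t)%N ->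
  0 < (orbit_poly p t)`_(1 + k * p.-1).
Proof.
move=> p_gt0; elim: t k => [//|t IHt] [_|k ltkt] /=; rewrite coefD coefX.
  by rewrite eqxx ltr_wpDl ?ltr01 //; apply/coef_nonneg_exp/orbit_poly_ge0.
have t_gt0 : (0 < t)%N by exact: leq_ltn_trans (leq0n k) ltkt.
set f := orbit_poly p t in IHt *; have f0 : coef_nonneg f by apply: orbit_poly_ge0.
rewrite ltr_wpDr ?ler0n // mulSn addnCA addnC -[in _ ^+ p](prednK p_gt0) exprS.
apply: coef_mul_gt0 => //; [exact: coef_nonneg_exp | exact: IHt |].
by apply: coef_exp_gt0 => //; have := IHt 0%N t_gt0.
Qed.

Definition orbits p : set A := [set x | exists c t,
  [/\ c \in T, (0 < t)%N & x = iter t (fun x => x ^+ p + c) 0]].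

Lemma orbits_powers p : (0 < p)%N ->
  {subset lspan (orbits p) <= lspan (powers p.-1 1)}.
Proof.
move=> p_gt0; apply: lspan_min => _ [c [t [Tc _ ->]]].
elim: t => [|t IHt]; first exact: rpred0.
rewrite iterS rpredD ?exp_powers1 //.
by apply: mem_lspan; exists c, 0%N.
Qed.

Lemma powers_orbits p : (0 < p)%N ->
  {subset lspan (powers p.-1 1) <= lspan (orbits p)}.
Proof.
move=> p_gt0; apply: lspan_min => _ [c [k [Tc ->]]].
set f := orbit_poly p k.+1; set m := (1 + _)%N.
have fm : 0 < f`_m by apply: orbit_poly_gt0.
have ltm : (m < size f)%N.
  by rewrite ltnNge; apply: contraL fm => /leq_sizeP-> //; rewrite ltxx.
rewrite -[_ ^+ _]scale1r -(mulVf (lt0r_neq0 fm)) -scalerA; apply: rpredZ.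
(* Along the line [a *: c] inside [T], the iterate given by [f] is a curve in [a] with these
   monomials as coefficients. *)
apply: (mem_coef_curve (v := fun i => f`_i *: c ^+ i)) ltm => a.
apply: mem_lspan; exists (a *: c), k.+1; split=> //; first exact: rpredZ.
rewrite horner_orbit_poly -/f /horner_alg /horner_morph /=.
rewrite -[X in map_poly _ X]coefK poly_def rmorph_sum horner_sum.
apply: eq_bigr => i _.
rewrite /= map_polyZ map_polyXn hornerZ hornerXn exprZn -scalerAl mul1r.
by rewrite !scalerA mulrC.
Qed.

Lemma orbits_exp p x : (0 < p)%N ->
  x \in lspan (orbits p) -> x ^+ p \in lspan (orbits p).
Proof.
by move=> p_gt0 /(orbits_powers p_gt0)/(exp_powers1 p_gt0)/(powers_orbits p_gt0).
Qed.

End PowerSpan.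

(** * The three properties of the relation *)

Section SameDynamics.
Variables (R : realType) (n p : nat) (p_gt0 : (0 < p)%N).
Implicit Types s : principal_slice R n p.

Lemma slice_space_sub_It s :
  {subset slice_space s <= lspan (iterates s)}.
Proof.
move=> c sc; apply: mem_lspan; exists c, 1%N; split=> //=.
by rewrite /Q expr0n eqn0Ngt p_gt0 add0r.
Qed.

Lemma It_Q s c x : c \in slice_space s ->
  x \in lspan (iterates s) -> Q p c x \in lspan (iterates s).
Proof.
move=> sc Ix; apply: rpredD; last exact: slice_space_sub_It.
(* [iterates s] is by conversion [orbits p] with [T] the slice space. *)
exact: (@orbits_exp R (multicomplex R n) (lspan _) p x p_gt0 Ix).
Qed.

Lemma same_dynamics_refl s : same_dynamics s s.
Proof.
exists idfun, id; split=> //.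
  apply/seteqP; split=> [_ [c sc <-] //|x sx].
  by exists (LSpan (slice_space_sub_It sx)).
move=> c eta sc.
by exists (LSpan (It_Q sc (valP eta))).
Qed.

Lemma same_dynamics_sym s1 s2 : same_dynamics s1 s2 -> same_dynamics s2 s1.
Proof.
move=> [phi [psi [phiK psiK im conj]]].
have lin_psi : linear psi by apply: (can2_linear phiK psiK).
pose lpsi := GRing.isLinear.Build R (It s2) (It s1) _ psi lin_psi.
pose Psi : {linear It s2 -> It s1} := HB.pack psi lpsi.
have phi_slice c : \val c \in slice_space s1 -> \val (phi c) \in slice_space s2.
  by move=> sc; have : [set` slice_space s2] (\val (phi c)) by rewrite -im; exists c.
have psi_slice d : \val d \in slice_space s2 -> \val (psi d) \in slice_space s1.
  move=> sd; have : [set` slice_space s2] (\val d) by [].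
  by rewrite -im => -[c sc /val_inj <-]; rewrite phiK.
exists Psi, phi; split=> //=.
  apply/seteqP; split=> [_ [d sd <-]|x sx]; first exact: psi_slice.
  exists (phi (LSpan (slice_space_sub_It sx))); rewrite /= ?phiK //.
  exact: phi_slice.
move=> d eta sd.
(* Since [psi (phi eta) = eta], [zeta] is the image of [eta] under the map with parameter [psi d];
   its image [phi zeta] is the point required for the inverse. *)
have [zeta zetaE phi_zeta] := conj (psi d) (phi eta) (psi_slice d sd).
by exists (phi zeta); rewrite ?phi_zeta ?psiK // phiK zetaE phiK.
Qed.

Lemma same_dynamics_trans s1 s2 s3 :
  same_dynamics s1 s2 -> same_dynamics s2 s3 -> same_dynamics s1 s3.
Proof.
move=> [f [f' [fK f'K imf conjf]]] [g [g' [gK g'K img conjg]]].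
have f_slice c : \val c \in slice_space s1 -> \val (f c) \in slice_space s2.
  by move=> sc; have : [set` slice_space s2] (\val (f c)) by rewrite -imf; exists c.
exists (g \o f), (f' \o g'); split.
- exact: can_comp.
- exact: can_comp.
- rewrite -img; apply/seteqP; split=> [_ [c sc <-]|_ [d sd <-]].
    by exists (f c) => //; apply: f_slice.
  have : [set` slice_space s2] (\val d) by [].
  by rewrite -imf => -[c sc /val_inj <-]; exists c.
move=> c eta sc.
have [zeta2 zeta2E g_zeta2] := conjg (f c) eta (f_slice c sc).
have [zeta1 zeta1E f_zeta1] := conjf c (g' eta) sc.
exists zeta1 => //.
(* [f zeta1] and [zeta2] both have the value [Q p (f c) (g' eta)], so they coincide and the two
   conjugacies chain. *)
by rewrite /= -g_zeta2; congr (\val (g _)); apply: val_inj; rewrite f_zeta1 zeta2E.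
Qed.

End SameDynamics.

Theorem theorem3 (R : realType) (n p : nat) (hn : (1 <= n)%N) (hp : (2 <= p)%N) :
  Equivalence (@same_dynamics R n p).
Proof.
have p_gt0 : (0 < p)%N by apply: ltnW.
split=> [s|s1 s2|s1 s2 s3].
- exact: same_dynamics_refl.
- exact: same_dynamics_sym.
- exact: same_dynamics_trans.
Qed.
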